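(* Let $K$ be a perfectoid field and $n\ge1$. An element $f=\sum_\alpha f_\alpha X^\alpha\in T_n^{\mathrm{perf}}=K\langle X_1^{1/p^\infty},\dots,X_n^{1/p^\infty}\rangle$ is a unit if and only if $|f_\alpha|<|f_0|$ for all $\alpha\ne0$.
   Context: $K$ is a perfectoid field of residue characteristic $p$. The perfectoid Tate algebra $T_n^{\mathrm{perf}}$ is the completion, for the Gauss norm, of $\bigcup_m K\langle X_1^{1/p^m},\dots,X_n^{1/p^m}\rangle$, i.e. the ring of formal series $\sum_{\alpha\in(\mathbb{Z}[1/p]_{\ge0})^n}f_\alpha X^\alpha$, $f_\alpha\in K$, such that for every real $\lambda>0$ only finitely many $|f_\alpha|\ge\lambda$. *)

(* Defs.v *)
From HB Require Import structures.
From mathcomp Require Import all_boot all_order all_algebra.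
From mathcomp Require Import finmap.
From mathcomp Require Import all_classical all_reals all_analysis.
From mathcomp Require Import ring lra zify.

Set Implicit Arguments.
Unset Strict Implicit.
Unset Printing Implicit Defensive.

Import Order.TTheory GRing.Theory Num.Theory.
Import numFieldNormedType.Exports.
Local Open Scope classical_set_scope.
Local Open Scope ring_scope.

(* A field complete for a nonarchimedean absolute value.  The ordered field R
   only receives the absolute value; K itself carries no order. *)
HB.mixin Record isCompleteNA (R : realType) K of GRing.Field K := {
  absv : K -> R;
  absv_ge0 : forall x, 0 <= absv x;
  absv_eq0 : forall x, (absv x == 0) = (x == 0);
  absvM : forall x y, absv (x * y) = absv x * absv y;
  absvD_le : forall x y, absv (x + y) <= Num.max (absv x) (absv y);
  absv_complete : forall u : nat -> K,
    (forall e : R, 0 < e -> exists N : nat, forall m n : nat,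
       (N <= m)%N -> (N <= n)%N -> absv (u m - u n) < e) ->
    exists l : K, forall e : R, 0 < e -> exists N : nat, forall n : nat,
       (N <= n)%N -> absv (u n - l) < e
}.

#[short(type="completeNAFieldType")]
HB.structure Definition CompleteNAField (R : realType) :=
  {K of GRing.Field K & isCompleteNA R K}.

Definition value_group (R : realType) (K : completeNAFieldType R) : set R :=
  [set absv x | x in [set x : K | x != 0]].

(* [absv_p_lt1] says that p is zero in the residue field, i.e. that the residue
   characteristic is p.  [frobenius_surj] is the surjectivity of x |-> x ^ p on
   K°/pK°, where K° is the closed unit ball: y ^ p is a preimage of x up to an
   element p * z of pK°. *)
HB.mixin Record isPerfectoid (R : realType) (p : nat) K
    of CompleteNAField R K := {
  residue_char_prime : prime p;
  absv_p_lt1 : absv (p%:R : K) < 1;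
  value_group_nondiscrete :
    ~ (value_group K `<=` isolated (value_group K));
  frobenius_surj : forall x : K, absv x <= 1 ->
    exists2 y : K, absv y <= 1 &
    exists2 z : K, absv z <= 1 & x - y ^+ p = p%:R * z
}.

#[short(type="perfectoidFieldType")]
HB.structure Definition PerfectoidField (R : realType) (p : nat) :=
  {K of CompleteNAField R K & isPerfectoid R p K}.

(* Z[1/p]_{>=0}: the nonnegative rationals whose reduced denominator has no
   prime factor other than p. *)
Definition nnzinv_pred (p : nat) : pred rat :=
  fun q => (0 <= q) && p.-nat `|denq q|%N.

Record nnzinv (p : nat) := NNZinv {
  nnzinv_val :> rat; nnzinv_valP : nnzinv_pred p nnzinv_val }.

HB.instance Definition _ p := [isSub for @nnzinv_val p].
HB.instance Definition _ p := [Choice of nnzinv p by <:].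

Lemma denqD_dvd (x y : rat) :
  (`|denq (x + y)| %| `|denq x| * `|denq y|)%N.
Proof.
have e : (denq x * denq y * numq (x + y))%R
  = ((numq x * denq y + numq y * denq x) * denq (x + y))%R.
  apply/eqP; rewrite -(eqr_int rat) !rmorphM rmorphD !rmorphM /=; apply/eqP.
  have nE z : (numq z)%:~R = z * (denq z)%:~R :> rat.
    by rewrite -{2}(divq_num_den z) divfK // intr_eq0 denq_neq0.
  by rewrite !nE; ring.
have : (denq (x + y) %| denq x * denq y * numq (x + y))%Z.
  by rewrite e dvdz_mull.
rewrite Gauss_dvdzl; last by rewrite /coprimez gcdzC; have := coprime_num_den (x + y); rewrite /gcdz /coprime => /eqP ->.
by rewrite dvdzE abszM.
Qed.

Lemma nnzinv_closed p : GRing.nmod_closed (nnzinv_pred p).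
Proof.
split; first by rewrite unfold_in /nnzinv_pred lexx.
move=> x y; rewrite !unfold_in /nnzinv_pred => /andP[x0 xp] /andP[y0 yp].
rewrite addr_ge0 //=; apply: pnat_dvd (denqD_dvd x y) _.
by rewrite pnatM xp yp.
Qed.

HB.instance Definition _ p :=
  GRing.SubChoice_isSubNmodule.Build rat (nnzinv_pred p) (nnzinv p)
    (nnzinv_closed p).

Definition expo (p n : nat) := {ffun 'I_n -> nnzinv p}.
HB.instance Definition _ p n := GRing.Nmodule.on (expo p n).

Section UnconditionalSums.
Variables (R : realType) (K : completeNAFieldType R) (I : choiceType).
Implicit Types (a b : I -> K) (s t : K).

Definition null_family a : Prop :=
  forall e : R, 0 < e -> finite_set [set i | e <= absv (a i)].

Definition has_sum a s : Prop :=
  forall e : R, 0 < e -> exists S0 : {fset I}, forall S : {fset I},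
    (S0 `<=` S)%fset -> absv (\sum_(i <- S) a i - s) < e.

(* The sum of a family; the value 0 is junk when the family has no sum. *)
Definition nasum a : K := xget 0 [set s | has_sum a s].

End UnconditionalSums.

Section AbsvTheory.
Variables (R : realType) (K : completeNAFieldType R).
Implicit Types (x y : K) (e : R).

Lemma absv0 : absv (0 : K) = 0.
Proof. by apply/eqP; rewrite absv_eq0. Qed.

Lemma absv_gt0 x : (0 < absv x) = (x != 0).
Proof. by rewrite lt_neqAle absv_ge0 andbT eq_sym absv_eq0. Qed.

Lemma absv1 : absv (1 : K) = 1.
Proof.
have h : absv (1 : K) != 0 by rewrite absv_eq0 oner_neq0.
by apply: (mulfI h); rewrite -absvM !mulr1.
Qed.

Lemma absvN x : absv (- x) = absv x.
Proof.
have /eqP : absv (-1 : K) ^+ 2 = 1 by rewrite expr2 -absvM mulrNN mulr1 absv1.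
rewrite sqrf_eq1 => /orP[] /eqP h; first by rewrite -mulN1r absvM h mul1r.
by have := absv_ge0 (-1 : K); rewrite h ler0N1.
Qed.

Lemma absvB x y : absv (x - y) = absv (y - x).
Proof. by rewrite -opprB absvN. Qed.

Lemma absvD_lt x y e : absv x < e -> absv y < e -> absv (x + y) < e.
Proof. by move=> hx hy; apply: le_lt_trans (absvD_le x y) _; rewrite gt_max hx. Qed.

Lemma absvB_lt x y e : absv x < e -> absv y < e -> absv (x - y) < e.
Proof. by move=> hx hy; apply: absvD_lt; rewrite ?absvN. Qed.

Lemma absv_dist_lt y x z e :
  absv (x - y) < e -> absv (y - z) < e -> absv (x - z) < e.
Proof. by move=> h1 h2; rewrite -(subrKA y); apply: absvD_lt. Qed.

Lemma absv_small x : (forall e, 0 < e -> absv x < e) -> x = 0.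
Proof.
move=> h; apply/eqP/negPn/negP; rewrite -absv_gt0 => hx.
by have := h _ hx; rewrite ltxx.
Qed.

Lemma absv_sum_lt (I : eqType) (s : seq I) (P : pred I) (F : I -> K) e :
  0 < e -> (forall i, i \in s -> P i -> absv (F i) < e) ->
  absv (\sum_(i <- s | P i) F i) < e.
Proof.
move=> e0 h; rewrite big_seq_cond.
apply: (big_ind (fun x => absv x < e)) => [|x y|i /andP[]]; first by rewrite absv0.
- exact: absvD_lt.
- exact: h.
Qed.

End AbsvTheory.

Section SumTheory.
Variables (R : realType) (K : completeNAFieldType R) (I : choiceType).
Implicit Types (a b : I -> K) (s t : K) (e : R) (S : {fset I}).

Lemma big_fset_split S0 S a : (S0 `<=` S)%fset ->
  \sum_(i <- S) a i = \sum_(i <- S0) a i + \sum_(i <- S | i \notin S0) a i.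
Proof.
move=> S0S; rewrite (bigID (mem S0)) /=; congr (_ + _).
rewrite big_fset_condE; apply: eq_fbigl => i.
rewrite !inE /=; apply/andP/idP => [[]//|iS0]; split=> //.
exact: (fsubsetP S0S).
Qed.

Lemma has_sum_unique a s t : has_sum a s -> has_sum a t -> s = t.
Proof.
move=> hs ht; apply/eqP; rewrite -subr_eq0; apply/eqP/absv_small => e e0.
have [S1 h1] := hs _ e0; have [S2 h2] := ht _ e0.
apply: (@absv_dist_lt _ _ (\sum_(i <- (S1 `|` S2)%fset) a i)).
  by rewrite absvB; apply: h1; apply: fsubsetUl.
by apply: h2; apply: fsubsetUr.
Qed.

Lemma null_has_sum a : null_family a -> exists s, has_sum a s.
Proof.
move=> na; pose S0 e := fset_set [set i | e <= absv (a i)].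
have hS0 e S : 0 < e -> (S0 e `<=` S)%fset ->
    absv (\sum_(i <- S) a i - \sum_(i <- S0 e) a i) < e.
  move=> e0 hS; rewrite (big_fset_split a hS) addrC addKr.
  apply: absv_sum_lt => // i _; rewrite in_fset_set; last exact: na.
  by rewrite notin_setE /= => /negP; rewrite -ltNge.
have inc e1 e2 : 0 < e1 -> e1 <= e2 -> (S0 e2 `<=` S0 e1)%fset.
  move=> e10 le12; rewrite -fset_set_sub; [|exact/na/(lt_le_trans e10)|exact: na].
  by move=> i /=; apply: le_trans.
pose r k : R := k.+1%:R^-1.
have r0 k : 0 < r k by rewrite invr_gt0.
have rle j k : (j <= k)%N -> r k <= r j.
  by move=> jk; rewrite lef_pV2 ?posrE // ler_nat.
have rsmall e : 0 < e -> exists N, r N < e.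
  move=> e0; exists (Num.bound (e^-1)).
  rewrite /r -[ltRHS]invrK ltf_pV2 ?posrE ?invr_gt0 //.
  apply: (lt_trans (archi_boundP _)); first by rewrite invr_ge0 ltW.
  by rewrite ltr_nat.
pose u k := \sum_(i <- S0 (r k)) a i.
have hu k m : (k <= m)%N -> absv (u m - u k) < r k.
  by move=> km; apply: hS0 => //; apply: inc => //; apply: rle.
have [|l hl] := @absv_complete R K u.
  move=> e e0; have [N rN] := rsmall e e0; exists N => m k Nm Nk.
  apply: (lt_trans _ rN).
  apply: (@absv_dist_lt _ _ (u N)); first exact: hu.
  by rewrite absvB; apply: hu.
exists l => e e0; have [N rN] := rsmall e e0; have [M hM] := hl e e0.
pose k := maxn N M; exists (S0 (r k)) => S hS.
apply: (@absv_dist_lt _ _ (u k)); last by apply: hM; rewrite leq_maxr.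
apply: lt_le_trans (hS0 _ _ (r0 k) hS) _.
by apply: le_trans (rle _ _ (leq_maxl N M)) (ltW rN).
Qed.

Lemma nasumP a : null_family a -> has_sum a (nasum a).
Proof. by move=> /null_has_sum [s hs]; rewrite /nasum; case: xgetP => [x _ //|/(_ s)]. Qed.

Lemma nasumE a s : has_sum a s -> nasum a = s.
Proof.
move=> hs; apply: (has_sum_unique _ hs); rewrite /nasum.
by case: xgetP => [x _ //|/(_ s)].
Qed.

Lemma has_sumD a b s t :
  has_sum a s -> has_sum b t -> has_sum (fun i => a i + b i) (s + t).
Proof.
move=> hs ht e e0; have [S1 h1] := hs _ e0; have [S2 h2] := ht _ e0.
exists (S1 `|` S2)%fset => S; rewrite fsubUset => /andP[hS1 hS2].
by rewrite big_split opprD addrACA absvD_lt ?h1 ?h2.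
Qed.

Lemma has_sum_lt a s e : 0 < e -> (forall i, absv (a i) < e) ->
  has_sum a s -> absv s < e.
Proof.
move=> e0 ha /(_ _ e0) [S /(_ S (fsubset_refl S)) h].
rewrite -[s](subKr (\sum_(i <- S) a i)); apply: absvB_lt => //.
by apply: absv_sum_lt.
Qed.

Lemma has_sum_single a j : (forall i, i != j -> a i = 0) -> has_sum a (a j).
Proof.
move=> h e e0; exists [fset j]%fset => S; rewrite fsub1set => jS.
rewrite (big_fsetD1 j) //= big_seq_cond big1 ?addr0 ?subrr ?absv0 // => i.
by rewrite !inE andbT => /andP[ij _]; apply: h.
Qed.

Lemma null_familyD a b :
  null_family a -> null_family b -> null_family (fun i => a i + b i).
Proof.
move=> na nb e e0.
apply: (@sub_finite_set _ _ ([set i | e <= absv (a i)] `|` [set i | e <= absv (b i)])).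
  move=> i /= h; have := le_trans h (absvD_le (a i) (b i)).
  by rewrite le_max => /orP.
by rewrite finite_setU; split; [exact: na|exact: nb].
Qed.

Lemma null_familyN a : null_family a -> null_family (fun i => - a i).
Proof. by move=> na e e0; under eq_set do rewrite absvN; exact: na. Qed.

Lemma null_bounded a : null_family a ->
  exists2 M : R, 0 < M & forall i, absv (a i) < M.
Proof.
move=> na; pose S := fset_set [set i | 1 <= absv (a i)].
exists (1 + \sum_(i <- S) absv (a i)).
  by rewrite ltr_pwDl // sumr_ge0 // => i _; apply: absv_ge0.
move=> i; case: (ltP (absv (a i)) 1) => h.
  by apply: (lt_le_trans h); rewrite lerDl sumr_ge0 // => j _; apply: absv_ge0.
have iS : i \in S by rewrite in_fset_set ?inE //; exact: na.
rewrite (big_fsetD1 i) //= addrCA ltrDl ltr_pwDl // sumr_ge0 // => j _.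
exact: absv_ge0.
Qed.

End SumTheory.

Lemma has_sum_swap (R : realType) (K : completeNAFieldType R) (I J : choiceType)
  (a : I * J -> K) (s : K) :
  has_sum a s -> has_sum (fun ji : J * I => a (ji.2, ji.1)) s.
Proof.
move=> hs e e0; have [S0 h0] := hs _ e0.
exists [fset (ij.2, ij.1) | ij in S0]%fset => S hS.
pose S' := [fset (ji.2, ji.1) | ji in S]%fset.
have -> : \sum_(i <- S) a (i.2, i.1) = \sum_(i <- S') a i.
  by rewrite big_imfset //= => -[j i] [j' i'] _ _ [-> ->].
apply: h0; apply/fsubsetP => -[i j] hij; apply/imfsetP; exists (j, i) => //=.
by apply: (fsubsetP hS); apply/imfsetP; exists (i, j).
Qed.

Section TatePerf.
Variables (R : realType) (p : nat) (K : completeNAFieldType R) (n : nat).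
Local Notation E := (expo p n).

(* The coefficient families of elements of K<X_1^{1/p^oo}, ..., X_n^{1/p^oo}>. *)
Definition tate_pred : pred (E -> K) := fun f => `[< null_family f >].

Record tate_perf := TatePerf {
  tate_coef :> E -> K; tate_coefP : tate_pred tate_coef }.

HB.instance Definition _ := [isSub for tate_coef].
HB.instance Definition _ := [Choice of tate_perf by <:].

Lemma tate_pred_closed : zmod_closed tate_pred.
Proof.
split; first apply/asboolP => e e0.
  under eq_set do rewrite absv0 leNgt e0.
  by rewrite (_ : [set _ | _] = set0) //; apply/seteqP; split.
move=> f g /asboolP nf /asboolP ng; apply/asboolP.
by apply: null_familyD => //; apply: null_familyN.
Qed.

HB.instance Definition _ :=
  GRing.isZmodClosed.Build (E -> K) tate_pred tate_pred_closed.
HB.instance Definition _ := [SubChoice_isSubZmodule of tate_perf by <:].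

Implicit Types (f g h : tate_perf) (a b c : E).

Lemma tate_null f : null_family f.
Proof. exact/asboolP/(tate_coefP f). Qed.

Lemma tateP f g : (forall a, f a = g a) -> f = g.
Proof. by move=> fg; apply/val_inj/funext. Qed.

Lemma tateDE f g a : (f + g) a = f a + g a. Proof. by []. Qed.
Lemma tateNE f a : (- f) a = - f a. Proof. by []. Qed.
Lemma tate0E a : (0 : tate_perf) a = 0. Proof. by []. Qed.

(* Cauchy product: the coefficient at c is the sum of the f_a * g_b over all
   a + b = c, in general an infinite convergent sum. *)
Definition cauchy_term f g c : E * E -> K :=
  fun ab => if ab.1 + ab.2 == c then f ab.1 * g ab.2 else 0.

Definition cauchy_coef f g c : K := nasum (cauchy_term f g c).

Definition one_coef a : K := (a == 0)%:R.

Lemma prod_finite f g (e : R) : 0 < e ->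
  finite_set [set ab : E * E | e <= absv (f ab.1 * g ab.2)].
Proof.
move=> e0.
have [M M0 hM] := null_bounded (tate_null f).
have [N N0 hN] := null_bounded (tate_null g).
apply: (@sub_finite_set _ _
  ([set a | e / N <= absv (f a)] `*` [set b | e / M <= absv (g b)])); last first.
  by apply: finite_setX; apply: tate_null; rewrite divr_gt0.
move=> [a b] /=; rewrite absvM => h; split=> /=.
  rewrite ler_pdivrMr //; apply: (le_trans h).
  by rewrite ler_wpM2l ?absv_ge0 // ltW.
rewrite ler_pdivrMr // mulrC; apply: (le_trans h).
by rewrite ler_wpM2r ?absv_ge0 // ltW.
Qed.

Lemma cauchy_null f g c : null_family (cauchy_term f g c).
Proof.
move=> e e0; apply: sub_finite_set (prod_finite f g e0) => -[a b] /=.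
by rewrite /cauchy_term /=; case: ifP => // _; rewrite absv0 leNgt e0.
Qed.

Lemma cauchy_has_sum f g c : has_sum (cauchy_term f g c) (cauchy_coef f g c).
Proof. exact/nasumP/cauchy_null. Qed.

Lemma cauchy_coef_null f g : tate_pred (cauchy_coef f g).
Proof.
apply/asboolP => e e0.
apply: sub_finite_set (finite_image (fun ab => ab.1 + ab.2) (prod_finite f g e0)).
move=> c /= hc; apply: contrapT => hn.
suff: absv (cauchy_coef f g c) < e by rewrite ltNge hc.
apply: (has_sum_lt e0 _ (cauchy_has_sum f g c)) => -[a b].
rewrite /cauchy_term /=; case: eqP => [abc|]; last by rewrite absv0.
by rewrite ltNge; apply/negP => h; apply: hn; exists (a, b).
Qed.

Lemma one_coef_null : tate_pred one_coef.
Proof.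
apply/asboolP => e e0; apply: (@sub_finite_set _ _ [set 0]) => // a /=.
by rewrite /one_coef; case: eqP => // _; rewrite absv0 leNgt e0.
Qed.

Definition tate_one : tate_perf := TatePerf one_coef_null.
Definition tate_mul f g : tate_perf := TatePerf (cauchy_coef_null f g).

Definition tate_lt f (M : R) : Prop := forall a, absv (f a) < M.

Lemma tate_mul_lt f g (M N : R) : 0 < M -> 0 < N ->
  tate_lt f M -> tate_lt g N -> tate_lt (tate_mul f g) (M * N).
Proof.
move=> M0 N0 hf hg c.
apply: (has_sum_lt _ _ (cauchy_has_sum f g c)); first exact: mulr_gt0.
move=> [a b]; rewrite /cauchy_term /=; case: eqP => _.
  by rewrite absvM ltr_pM ?absv_ge0.
by rewrite absv0 mulr_gt0.
Qed.

Lemma tate_mulC : commutative tate_mul.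
Proof.
move=> f g; apply: tateP => c /=; apply: nasumE.
have := has_sum_swap (cauchy_has_sum g f c).
congr has_sum; apply: funext => -[a b].
by rewrite /cauchy_term /= addrC mulrC.
Qed.

Lemma tate_mulDl : left_distributive tate_mul +%R.
Proof.
move=> f g h; apply: tateP => c /=; apply: nasumE.
have := has_sumD (cauchy_has_sum f h c) (cauchy_has_sum g h c).
congr has_sum; apply: funext => -[a b].
by rewrite /cauchy_term /=; case: ifP; rewrite ?addr0 // -mulrDl.
Qed.

Lemma tate_mulDr : right_distributive tate_mul +%R.
Proof. by move=> f g h; rewrite !(tate_mulC f) tate_mulDl. Qed.

Definition mono_coef (x : K) a : E -> K := fun b => if b == a then x else 0.

Lemma mono_coef_null x a : tate_pred (mono_coef x a).
Proof.
apply/asboolP => e e0; apply: (@sub_finite_set _ _ [set a]) => // b /=.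
by rewrite /mono_coef; case: eqP => // _; rewrite absv0 leNgt e0.
Qed.

Definition mono x a : tate_perf := TatePerf (mono_coef_null x a).

Lemma monoE x a b : mono x a b = if b == a then x else 0. Proof. by []. Qed.

Lemma mono_mul x y a b : tate_mul (mono x a) (mono y b) = mono (x * y) (a + b).
Proof.
apply: tateP => c /=; apply: nasumE.
have -> : mono_coef (x * y) (a + b) c = cauchy_term (mono x a) (mono y b) c (a, b).
  by rewrite /cauchy_term /mono_coef /= /mono_coef !eqxx eq_sym.
apply: has_sum_single => -[a' b']; rewrite xpair_eqE negb_and /cauchy_term /=.
rewrite /mono_coef; case: ifP => // _ /orP[] /negPf ->; first by rewrite mul0r.
by rewrite mulr0.
Qed.

Lemma tate_mul1 : left_id tate_one tate_mul.
Proof.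
move=> f; apply: tateP => c /=; apply: nasumE.
have -> : f c = cauchy_term tate_one f c (0, c).
  by rewrite /cauchy_term /= add0r eqxx /one_coef eqxx mul1r.
apply: has_sum_single => -[a b]; rewrite /cauchy_term /= /one_coef.
case: (eqVneq a 0) => [->|a0]; last by rewrite mul0r if_same.
rewrite add0r xpair_eqE eqxx /= => /negPf ->; by [].
Qed.

Lemma tate_sumE (S : seq E) (F : E -> tate_perf) b :
  (\sum_(a <- S) F a) b = \sum_(a <- S) F a b.
Proof. by apply: (big_morph (fun f : tate_perf => f b)). Qed.

Lemma mono_approx f (e : R) : 0 < e -> exists S : seq E,
  tate_lt (f - \sum_(a <- S) mono (f a) a) e.
Proof.
move=> e0; pose S := fset_set [set a | e <= absv (f a)]; exists S => b.
rewrite tateDE tateNE tate_sumE.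
have [bS|bS] := boolP (b \in S).
  rewrite (big_fsetD1 b) //= /mono_coef eqxx big_seq_cond big1 ?addr0 ?subrr ?absv0 //.
  by move=> a; rewrite !inE andbT => /andP[/negPf]; rewrite eq_sym => ->.
rewrite big_seq_cond big1 ?subr0.
  move: bS; rewrite in_fset_set; last exact: tate_null.
  by rewrite notin_setE /= => /negP; rewrite -ltNge.
move=> a; rewrite andbT monoE; case: eqP => // <-.
by rewrite (negPf bS).
Qed.

Lemma tate_density (Phi : tate_perf -> tate_perf) (C : R) : 0 < C ->
  {morph Phi : f g / f + g} ->
  (forall f (M : R), 0 < M -> tate_lt f M -> tate_lt (Phi f) (M * C)) ->
  (forall x a, Phi (mono x a) = 0) -> forall f, Phi f = 0.
Proof.
move=> C0 PhiD Phib Phi0 f; apply: tateP => c; apply: absv_small => e e0.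
have P0 : Phi 0 = 0.
  by apply: (addrI (Phi 0)); rewrite -PhiD !addr0.
have [S hS] := mono_approx f (divr_gt0 e0 C0).
rewrite -[f](subrK (\sum_(a <- S) mono (f a) a)) PhiD.
have -> : Phi (\sum_(a <- S) mono (f a) a) = 0.
  by rewrite (big_morph Phi PhiD P0) big1 // => a _; apply: Phi0.
rewrite addr0.
by have := Phib _ _ (divr_gt0 e0 C0) hS c; rewrite divfK ?gt_eqF.
Qed.

Lemma tate_bounded f : exists2 M : R, 0 < M & tate_lt f M.
Proof. exact: null_bounded (tate_null f). Qed.

Lemma tate_lt_sub f g M : tate_lt f M -> tate_lt g M -> tate_lt (f - g) M.
Proof. by move=> hf hg a; rewrite tateDE tateNE absvB_lt. Qed.

Lemma tate_mulA : associative tate_mul.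
Proof.
pose D f g h := tate_mul f (tate_mul g h) - tate_mul (tate_mul f g) h.
have D_lt f g h (M N P : R) : 0 < M -> 0 < N -> 0 < P ->
    tate_lt f M -> tate_lt g N -> tate_lt h P -> tate_lt (D f g h) (M * (N * P)).
  move=> M0 N0 P0 hf hg hh; apply: tate_lt_sub.
    by do 2?apply: tate_mul_lt => //; rewrite ?mulr_gt0.
  by rewrite mulrA; do 2?apply: tate_mul_lt => //; rewrite ?mulr_gt0.
have D1 g h : {morph (fun f => D f g h) : f f' / f + f'}.
  by move=> f f'; rewrite /D !tate_mulDl opprD addrACA.
have D2 f h : {morph (fun g => D f g h) : g g' / g + g'}.
  by move=> g g'; rewrite /D !(tate_mulDl, tate_mulDr) opprD addrACA.
have D3 f g : {morph (fun h => D f g h) : h h' / h + h'}.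
  by move=> h h'; rewrite /D !tate_mulDr opprD addrACA.
suff D0 f g h : D f g h = 0 by move=> f g h; apply/eqP; rewrite -subr_eq0 -/(D f g h) D0.
have [F F0 hF] := tate_bounded f; have [G G0 hG] := tate_bounded g.
have [H H0 hH] := tate_bounded h.
apply: (@tate_density (fun f => D f g h) (G * H)); rewrite ?mulr_gt0 //.
  by move=> f' M M0 hf'; apply: D_lt.
move=> x a; have [A A0 hA] := tate_bounded (mono x a).
apply: (@tate_density (fun g => D (mono x a) g h) (A * H)); rewrite ?mulr_gt0 //.
  by move=> g' M M0 hg'; rewrite mulrCA; apply: D_lt.
move=> y b; have [B B0 hB] := tate_bounded (mono y b).
apply: (@tate_density (fun h => D (mono x a) (mono y b) h) (A * B));
  rewrite ?mulr_gt0 //.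
  by move=> h' M M0 hh'; rewrite mulrC -mulrA; apply: D_lt.
by move=> z c; rewrite /D !mono_mul mulrA addrA subrr.
Qed.

Lemma tate_one_neq0 : tate_one != 0.
Proof.
apply/eqP => /(congr1 (fun f : tate_perf => f 0)) /=.
by rewrite /one_coef eqxx => /eqP; rewrite oner_eq0.
Qed.

HB.instance Definition _ := GRing.Zmodule_isComNzRing.Build tate_perf
  tate_mulA tate_mulC tate_mul1 tate_mulDl tate_one_neq0.

Definition tate_unit : pred tate_perf := fun f => `[< exists g, g * f = 1 >].
Definition tate_inv f : tate_perf :=
  if pselect (exists g, g * f = 1) is left H then projT1 (cid H) else f.

Lemma tate_mulVf : {in tate_unit, left_inverse 1 tate_inv *%R}.
Proof.
move=> f /asboolP fu; rewrite /tate_inv; case: pselect => // H.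
by case: (cid H).
Qed.

Lemma tate_unitPl f g : g * f = 1 -> tate_unit f.
Proof. by move=> gf; apply/asboolP; exists g. Qed.

Lemma tate_inv_out : {in [predC tate_unit], tate_inv =1 id}.
Proof.
move=> f /negP fu; rewrite /tate_inv; case: pselect => // H.
by case: fu; apply/asboolP.
Qed.

HB.instance Definition _ := GRing.ComNzRing_hasMulInverse.Build tate_perf
  tate_mulVf tate_unitPl tate_inv_out.

Lemma tate_coef1 a : (1 : tate_perf) a = (a == 0)%:R. Proof. by []. Qed.

Lemma tate_coefM f g c : has_sum
  (fun ab : E * E => if ab.1 + ab.2 == c then f ab.1 * g ab.2 else 0)
  ((f * g) c).
Proof. exact: cauchy_has_sum. Qed.

Lemma tate_unitE f :
  f \is a GRing.unit <-> exists g, g * f = 1.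
Proof. by split=> [/asboolP|fu]; last exact/asboolP. Qed.

End TatePerf.

(* Main.v *)
Require Import Defs.
From mathcomp Require Import all_boot all_order all_algebra.
From mathcomp Require Import all_classical all_reals all_analysis.
From mathcomp Require Import ring lra.

Set Implicit Arguments.
Unset Strict Implicit.
Unset Printing Implicit Defensive.

Import Order.TTheory GRing.Theory Num.Theory.
Local Open Scope ring_scope.

(** If the constant term strictly dominates, dividing by it brings [f] to the
form [1 - h] where every coefficient of [h] has absolute value below 1.  As the
coefficients tend to 0, they are even bounded by some [r < 1], so the geometric
series of [h] converges for the Gauss norm and inverts [1 - h]
([tate_unit_1B]).

Conversely, let [g * f = 1], and let [A], [B] be the finite nonempty sets of
exponents at which [f], [g] attain their Gauss norms [M], [N].  The key is to
find [a] in [A] and [b] in [B] such that [a + b] has no other decomposition in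
[A + B]: in the sum defining the coefficient of [f * g] at [a + b], the term
[f a * g b] then has absolute value [M * N] and all the others are smaller, so
this coefficient is nonzero, and [f * g = 1] forces [a + b = 0].  A monomial
order would provide such a pair; here [(a, b)] is instead chosen to maximize
the Euclidean norm of [a + b], and uniqueness follows from the parallelogram
identity ([sqnorm_argmax_unique]).  This choice gives the rest at once: the
maximal norm being 0, all of [A + B] is reduced to 0, hence so is [A] because
exponents are nonnegative.  Thus [f] attains its Gauss norm only at 0. *)

(** * Families tending to zero *)

Lemma finite_set_argmax (d : Order.disp_t) (T : orderType d) (I : choiceType)
    (A : set I) (w : I -> T) :
  finite_set A -> (A !=set0)%classic ->
  exists2 i, A i & forall j, A j -> (w j <= w i)%O.
Proof.
move=> /finite_seqP[s ->] [i0 i0s]; elim: s i0 i0s => // x s IH i0 _.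
case: s IH => [_|y s /(_ y)]; first by exists x => [|j]; rewrite /= inE // => /eqP ->.
case=> [|i si imax]; first exact: mem_head.
have [le|/ltW le] := leP (w x) (w i).
  by exists i => [|j]; rewrite /= inE ?si ?orbT // => /orP[/eqP -> //|/imax].
exists x => [|j]; rewrite /= inE ?eqxx // => /orP[/eqP -> //|/imax h].
exact: le_trans h le.
Qed.

Section NullFamilies.
Variables (R : realType) (K : completeNAFieldType R) (I : choiceType).
Implicit Types (a : I -> K) (e : R).

Lemma null_family_argmax a i0 : null_family a -> a i0 != 0 ->
  exists2 i, a i != 0 & forall j, absv (a j) <= absv (a i).
Proof.
move=> na ai0; have ai0_gt0 : 0 < absv (a i0) by rewrite absv_gt0.
have [|i /= i0i imax] := finite_set_argmax (fun i => absv (a i)) (na _ ai0_gt0).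
  by exists i0 => /=.
exists i => [|j]; first by rewrite -absv_gt0 (lt_le_trans ai0_gt0).
have [/ltW ji0|/imax //] := ltP (absv (a j)) (absv (a i0)).
exact: le_trans ji0 i0i.
Qed.

(** A null family attains its supremum, so a strict pointwise bound leaves room
for a smaller uniform one; this supplies the ratio of the geometric series. *)
Lemma null_family_lt_gap a e : 0 < e -> null_family a ->
  (forall i, absv (a i) < e) ->
  exists2 r, 0 < r < e & forall i, absv (a i) < r.
Proof.
move=> e0 na ae; have [[i0 ai0]|a0] := pselect (exists i, a i != 0).
  have [i _ imax] := null_family_argmax na ai0.
  have := ae i; have := absv_ge0 (a i) => ai_ge0 ai_lt.
  exists ((absv (a i) + e) / 2); first by lra.
  by move=> j; apply: le_lt_trans (imax j) _; lra.
exists (e / 2) => [|i]; first by lra.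
have -> : a i = 0 by apply/eqP/negPn/negP => ai; apply: a0; exists i.
by rewrite absv0; lra.
Qed.

(** The strict ultrametric inequality for infinite sums: a single strictly
largest term cannot be cancelled by the others. *)
Lemma has_sum_dominant a s j e : 0 < e -> has_sum a s -> absv (a j) = e ->
  (forall i, i != j -> absv (a i) < e) -> s != 0.
Proof.
move=> e0 hs aj ae; apply/eqP => s0; move: hs; rewrite s0 => hs.
have ha : has_sum (fun i => if i == j then - a j else 0) (- a j).
  have := @has_sum_single R K I (fun i => if i == j then - a j else 0) j.
  by rewrite eqxx; apply => i /negPf ->.
(* Removing the term at j leaves a family below e whose sum is - a j. *)
have := has_sum_lt e0 _ (has_sumD hs ha); rewrite add0r absvN aj ltxx => h.
suff: false by []. apply: h => i; case: (eqVneq i j) => [->|ij].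
  by rewrite subrr absv0.
by rewrite addr0 ae.
Qed.

End NullFamilies.

(** * Exponents and their Euclidean norm *)

Section Exponents.
Variables (p n : nat).
Implicit Types (a b : expo p n).

Definition sqnorm a : rat := \sum_i (a i : rat) ^+ 2.

Lemma sqnorm_ge0 a : 0 <= sqnorm a.
Proof. by apply: sumr_ge0 => i _; apply: sqr_ge0. Qed.

Lemma expoDE a b i : ((a + b) i : rat) = (a i : rat) + (b i : rat).
Proof. by rewrite ffunE. Qed.

Lemma expo_addr_eq0 a b : a + b = 0 -> a = 0.
Proof.
move=> /ffunP ab0; apply/ffunP => i; apply: val_inj => /=.
have := congr1 val (ab0 i); rewrite !ffunE /=.
have /andP[a0 _] := nnzinv_valP (a i); have /andP[b0 _] := nnzinv_valP (b i).
lra.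
Qed.

Lemma sqnorm_le0 a : sqnorm a <= 0 -> a = 0.
Proof.
move=> a0; have /eqP : sqnorm a = 0 by apply/le_anti; rewrite a0 sqnorm_ge0.
rewrite psumr_eq0 => [/allP h|i _]; last exact: sqr_ge0.
apply/ffunP => i; apply: val_inj; rewrite !ffunE /=; apply/eqP.
by have := h i (mem_index_enum i); rewrite /= sqrf_eq0.
Qed.

(** If [a + b = a' + b'] and [d = a' - a], the crossed sums [a + b'] and
[a' + b] equal [(a + b) - d] and [(a + b) + d].  By the parallelogram identity
one of them is longer than [a + b] unless [d = 0]. *)
Lemma sqnorm_argmax_unique (A B : set (expo p n)) a b a' b' :
  (forall c d, A c -> B d -> sqnorm (c + d) <= sqnorm (a + b)) ->
  A a -> B b -> A a' -> B b' -> a' + b' = a + b -> (a', b') = (a, b).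
Proof.
move=> ab_max Aa Bb Aa' Bb' e.
have ei i : (a' i : rat) + (b' i : rat) = (a i : rat) + (b i : rat).
  by have := congr1 (fun c : expo p n => (c i : rat)) e; rewrite !expoDE.
have par : sqnorm (a + b') + sqnorm (a' + b)
    = 2 * sqnorm (a + b) + 2 * \sum_i ((a' i : rat) - (a i : rat)) ^+ 2.
  rewrite /sqnorm !mulr_sumr -!big_split; apply: eq_bigr => i _ /=.
  rewrite !expoDE; have -> : (b' i : rat) = (a i : rat) + (b i : rat) - (a' i : rat) by have := ei i; lra.
  by ring.
have d_ge0 i : true -> 0 <= ((a' i : rat) - (a i : rat)) ^+ 2 by rewrite sqr_ge0.
have /eqP : \sum_i ((a' i : rat) - (a i : rat)) ^+ 2 = 0.
  apply/le_anti; rewrite sumr_ge0 // andbT.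
  by have := ab_max _ _ Aa Bb'; have := ab_max _ _ Aa' Bb; lra.
rewrite psumr_eq0 // => /allP d0.
have ai i : (a' i : rat) = a i.
  by have := d0 i (mem_index_enum i); rewrite /= sqrf_eq0 subr_eq0 => /eqP.
congr pair; apply/ffunP => i; apply: val_inj => /=; first exact: ai.
by have := ei i; have := ai i; lra.
Qed.

Lemma expo_exists_neq0 : (1 <= n)%N -> exists a, a != 0.
Proof.
move=> n0; have one_p : nnzinv_pred p 1 by [].
exists [ffun=> NNZinv one_p]; apply/eqP => /ffunP /(_ (Ordinal n0)).
by rewrite !ffunE => /(congr1 val).
Qed.

End Exponents.

(** * Units of the perfectoid Tate algebra *)

Section TatePerfUnits.
Variables (R : realType) (p : nat) (K : completeNAFieldType R) (n : nat).
Implicit Types (f g h : tate_perf p K n) (a b c : expo p n) (e r : R).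

(** Completeness for the Gauss norm.  The limit is taken coefficientwise; it is
a null family because it is uniformly close to some [F N]. *)
Lemma tate_complete (F : nat -> tate_perf p K n) :
  (forall e, 0 < e -> exists N, forall k m, (N <= k)%N -> (N <= m)%N ->
     tate_lt (F k - F m) e) ->
  exists g, forall e, 0 < e -> exists N, forall k, (N <= k)%N ->
    tate_lt (F k - g) e.
Proof.
move=> cF.
have lim c : exists l : K, forall e, 0 < e -> exists N, forall k, (N <= k)%N ->
    absv (F k c - l) < e.
  apply: absv_complete => e /cF[N hN]; exists N => k m Nk Nm.
  exact: hN.
pose G c := projT1 (cid (lim c)).
have GP e : 0 < e -> exists N, forall k, (N <= k)%N ->
    forall c, absv (F k c - G c) < e.
  move=> e0; have [N hN] := cF _ e0; exists N => k Nk c.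
  have [M hM] := projT2 (cid (lim c)) _ e0.
  apply: (@absv_dist_lt _ _ (F (maxn N M) c)).
    by apply: (hN k (maxn N M) Nk); rewrite leq_maxl.
  by apply: hM; rewrite leq_maxr.
have nG : tate_pred G.
  apply/asboolP => e e0; have [N hN] := GP _ e0.
  apply: sub_finite_set (tate_null (F N) e0) => c /= Gc.
  rewrite leNgt; apply/negP => Fc; move: Gc; rewrite leNgt => /negP; apply.
  rewrite -[G c](subKr (F N c)); exact: absvB_lt (hN _ (leqnn N) c).
by exists (TatePerf nG) => e /GP.
Qed.

Lemma tate_lt_sum (I : eqType) (s : seq I) (F : I -> tate_perf p K n) e :
  0 < e -> (forall i, i \in s -> tate_lt (F i) e) ->
  tate_lt (\sum_(i <- s) F i) e.
Proof.
move=> e0 hF; rewrite big_seq.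
elim/big_ind: _ => // [c|u v hu hv c]; first by rewrite tate0E absv0.
by rewrite tateDE absvD_lt.
Qed.

(** The exponent is shifted because the strict bound fails for [h ^+ 0 = 1]. *)
Lemma tate_lt_exp h r k : 0 < r -> tate_lt h r -> tate_lt (h ^+ k.+1) (r ^+ k.+1).
Proof.
move=> r0 hr; elim: k => [|k IH]; first by rewrite !expr1.
rewrite exprS [r ^+ _]exprS; apply: tate_mul_lt => //.
exact: exprn_gt0.
Qed.

Lemma geometric_small r e : 0 < r < 1 -> 0 < e ->
  exists N, forall k, (N <= k)%N -> r ^+ k < e.
Proof.
move=> /andP[r0 r1] e0.
have r_lt1 : `|r| < 1 by rewrite ger0_norm // ltW.
have [N _ hN] := @cvgr0_norm_lt _ _ _ _ _ _ (cvg_expr r_lt1) e e0.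
exists N => k /hN /=; rewrite ger0_norm // exprn_ge0 //; exact: ltW.
Qed.

(** The inverse is the limit [g] of the partial sums [S k] of the geometric
series: since [S k * (1 - h) = 1 - h ^+ k], the defect [g * (1 - h) - 1] is
arbitrarily small. *)
Lemma tate_unit_1B h r : 0 < r < 1 -> tate_lt h r -> 1 - h \is a GRing.unit.
Proof.
move=> r01 hr; have /andP[r0 r1] := r01.
have small e : 0 < e -> exists N, forall k, (N <= k)%N -> tate_lt (h ^+ k) e.
  move=> e0; have [N hN] := geometric_small r01 e0.
  exists N.+1 => -[//|k] Nk c; apply: lt_trans (hN _ (ltnW Nk)).
  exact: tate_lt_exp.
pose S k := \sum_(0 <= i < k) h ^+ i.
have [|g hg] := @tate_complete S.
  move=> e e0; have [N hN] := small _ e0; exists N.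
  have S_lt k m : (N <= m)%N -> (m <= k)%N -> tate_lt (S k - S m) e.
    move=> Nm mk; rewrite /S (big_cat_nat (leq0n m) mk) addrAC subrr add0r.
    apply: tate_lt_sum => // i; rewrite mem_index_iota => /andP[mi _].
    exact/hN/(leq_trans Nm).
  move=> k m Nk Nm; have [mk|/ltnW km] := leqP m k; first exact: S_lt.
  by move=> c; rewrite -opprB absvN; apply: S_lt.
apply/tate_unitE; exists g; apply/eqP; rewrite -subr_eq0; apply/eqP.
apply: tateP => c; apply: absv_small => e e0.
have [M M0 hM] := tate_bounded (1 - h).
have [N hN] := small _ e0; have [N' hN'] := hg _ (divr_gt0 e0 M0).
pose k := maxn N N'.
have -> : g * (1 - h) - 1 = - ((S k - g) * (1 - h)) - h ^+ k.
  have SE : S k * (1 - h) = 1 - h ^+ k.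
    by rewrite mulrC /S big_mkord -[1 - h]opprB mulNr -subrX1 opprB.
  by rewrite mulrBl opprB SE -addrA -opprD subrK.
have Sg_lt : tate_lt ((S k - g) * (1 - h)) e.
  rewrite -[e](divfK (lt0r_neq0 M0)); apply: tate_mul_lt => //.
    exact: divr_gt0.
  by apply: hN'; rewrite leq_maxr.
apply: absvB_lt; last by apply: hN; rewrite leq_maxl.
by have := Sg_lt c; rewrite -absvN.
Qed.

Lemma tate_mono0ME x f c : (mono x 0 * f) c = x * f c.
Proof.
apply: has_sum_unique (tate_coefM _ _ _) _.
pose t (ab : expo p n * expo p n) :=
  if ab.1 + ab.2 == c then mono x 0 ab.1 * f ab.2 else 0.
have -> : x * f c = t (0, c) by rewrite /t /= add0r eqxx /mono_coef eqxx.
apply: has_sum_single => -[a b]; rewrite /t /= /mono_coef.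
case: (eqVneq a 0) => [->|a0]; last by rewrite mul0r if_same.
by rewrite add0r xpair_eqE eqxx /= => /negPf ->.
Qed.

Lemma tate_unit_of_dominant_const f : f 0 != 0 ->
  (forall a, a != 0 -> absv (f a) < absv (f 0)) -> f \is a GRing.unit.
Proof.
move=> f0 hf; have f0_gt0 : 0 < absv (f 0) by rewrite absv_gt0.
pose u : tate_perf p K n := mono (f 0)^-1 0.
have h1 c : absv ((1 - u * f) c) < 1.
  rewrite tateDE tateNE tate_coef1 tate_mono0ME.
  have [->|c0] := eqVneq c 0; first by rewrite mulVf // subrr absv0.
  rewrite sub0r absvN -(absv1 K) -(mulVf f0) !absvM ltr_pM2l ?hf //.
  by rewrite absv_gt0 invr_eq0.
have [r r01 hr] := null_family_lt_gap ltr01 (tate_null (1 - u * f)) h1.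
have : u * f \is a GRing.unit by rewrite -[u * f](subKr 1) (tate_unit_1B r01).
by rewrite unitrM => /andP[].
Qed.

(** Gauss norms are attained by [f] on [A] and by [g] on [B]; the pair of
[A * B] with the longest sum contributes a term of [f * g] that nothing
cancels, so its exponent is 0 and, by maximality, so are all those of [A]. *)
Lemma tate_mul1_dominant_const f g : g * f = 1 ->
  forall a, a != 0 -> absv (f a) < absv (f 0).
Proof.
move=> gf1.
have nz (u v : tate_perf p K n) : u * v = 1 -> exists a, u a != 0.
  move=> uv1; apply: contrapT => u0.
  suff u00 : u = 0 by move: uv1 => /eqP; rewrite u00 mul0r eq_sym oner_eq0.
  apply: tateP => a; apply/eqP/negPn/negP => ua; apply: u0; by exists a.
have [a0 /(null_family_argmax (tate_null f))[a1 fa1 fmax]] := nz f g (etrans (mulrC _ _) gf1).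
have [b0 /(null_family_argmax (tate_null g))[b1 gb1 gmax]] := nz g f gf1.
pose M := absv (f a1); pose N := absv (g b1).
have M0 : 0 < M by rewrite absv_gt0.
have N0 : 0 < N by rewrite absv_gt0.
pose A := [set a | M <= absv (f a)]%classic; pose B := [set b | N <= absv (g b)]%classic.
have [|[a b] /= [Aa Bb] abmax] := finite_set_argmax
    (fun ab => sqnorm (ab.1 + ab.2)) (finite_setX (tate_null f M0) (tate_null g N0)).
  by exists (a1, b1); split=> /=.
have fa : absv (f a) = M by apply/le_anti; rewrite fmax.
have gb : absv (g b) = N by apply/le_anti; rewrite gmax.
have abmax' c d : A c -> B d -> sqnorm (c + d) <= sqnorm (a + b).
  by move=> Ac Bd; apply: (abmax (c, d)).
(* A term (c, d) as large as the one at (a, b) must lie in A * B, where (a, b)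
   is the only decomposition of a + b. *)
have : (f * g) (a + b) != 0.
  apply: (has_sum_dominant (j := (a, b)) (mulr_gt0 M0 N0) (tate_coefM f g (a + b))).
    by rewrite eqxx absvM fa gb.
  move=> [c d] cd /=; case: eqP => [e|_]; last by rewrite absv0 mulr_gt0.
  rewrite absvM ltNge; apply/negP => le; case/eqP: cd.
  apply: (@sqnorm_argmax_unique p n A B) => //; rewrite /A /B /= leNgt; apply/negP => lt.
    move: le; apply/negP; rewrite -ltNge; apply: le_lt_trans (ler_wpM2l (absv_ge0 _) (gmax d)) _.
    by rewrite ltr_pM2r.
  move: le; apply/negP; rewrite -ltNge; apply: le_lt_trans (ler_wpM2r (absv_ge0 _) (fmax c)) _.
  by rewrite ltr_pM2l.
rewrite mulrC gf1 tate_coef1; have [ab0 _|] := eqVneq (a + b) 0; last by rewrite eqxx.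
have A0 c : A c -> c = 0.
  move=> Ac; apply: (@expo_addr_eq0 _ _ _ b); apply: sqnorm_le0.
  apply: le_trans (abmax' _ _ Ac Bb) _.
  by rewrite ab0 /sqnorm big1 // => i _; rewrite ffunE /= expr0n.
rewrite -(A0 a Aa) => c c0; rewrite fa ltNge; apply/negP => Ac.
by move: c0; rewrite (A0 a Aa) (A0 c Ac) eqxx.
Qed.

End TatePerfUnits.

Theorem corollary2p7 (R : realType) (p : nat) (K : perfectoidFieldType R p)
    (n : nat) (hn : (1 <= n)%N) (f : tate_perf p K n) :
  f \is a GRing.unit <->
  (forall a : expo p n, a != 0 -> absv (f a) < absv (f 0)).
Proof.
split=> [/tate_unitE[g gf1]|hf]; first exact: tate_mul1_dominant_const gf1.
(* A nonzero exponent exists as n >= 1; the hypothesis there makes f 0 nonzero. *)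
have [a a0] := expo_exists_neq0 p hn.
apply: tate_unit_of_dominant_const => //.
by rewrite -absv_gt0; apply: le_lt_trans (absv_ge0 _) (hf a a0).
Qed.
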